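(* Let $q$ be a prime power, $r\ge 2$ an integer, and $u$ a positive integer with $u \mid \frac{q^r-1}{q-1}$. Let $\mathcal{M}\subseteq\Delta\left(x^{(q-1)u+1},y^{q^{r-1}}\right)$ be a nonempty set of monomials closed under divisibility. Then the decreasing norm-trace code $\mathrm{ev}(\mathcal{M})$ has the following basic parameters. (1) Its length is $n=|\mathcal{X}_u|=((q-1)u+1)q^{r-1}$. (2) Its dimension over $\mathbb{F}_{q^r}$ is $k=|\mathcal{M}|$. (3) Its minimum distance is $$d=((q-1)u+1)q^{r-1}-\max\left\{\min\left(aq^{r-1}+(u(q-1)+1-a)b,\ aq^{r-1}+bu\right) : x^ay^b\in\mathcal{M}\right\}.$$
   Context: Let $Tr(y)=y^{q^{r-1}}+y^{q^{r-2}}+\cdots+y^q+y$ and let $\mathcal{X}_u=\{(\alpha,\beta)\in\mathbb{F}_{q^r}^2:\alpha^u=Tr(\beta)\}=\{P_1,\dots,P_n\}$ be the set of rational points of the (affine) extended norm-trace curve. The evaluation map is $\mathrm{ev}:\mathbb{F}_{q^r}[x,y]\to\mathbb{F}_{q^r}^n$, $f\mapsto(f(P_1),\dots,f(P_n))$. A set $\mathcal{M}$ of monomials in $x,y$ is closed under divisibility if $M\in\mathcal{M}$ and $M'\mid M$ imply $M'\in\mathcal{M}$. For a set $\mathcal{M}$ of monomials, $\mathrm{ev}(\mathcal{M})$ denotes the image under $\mathrm{ev}$ of the $\mathbb{F}_{q^r}$-span of $\mathcal{M}$; it is called a decreasing norm-trace code when $\mathcal{M}$ is closed under divisibility. $\Delta(x^i,y^j)$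 denotes the set of monomials in $x,y$ that are multiples of neither $x^i$ nor $y^j$. The minimum distance is the minimum Hamming weight of a nonzero codeword. *)

(* Defs.v *)
From HB Require Import structures.
From mathcomp Require Export all_boot all_order all_algebra.
From mathcomp Require Export finmap.
From mathcomp.multinomials Require Export freeg mpoly.

Set Implicit Arguments.
Unset Strict Implicit.
Unset Printing Implicit Defensive.

Import GRing.Theory.

Local Open Scope ring_scope.

(* Monomials in x, y are multi-indices 'X_{1..2}: coordinate 0 is the exponent
   of x and coordinate 1 the exponent of y; (m1 <= m2)%MM is divisibility. *)

Definition in_Delta (i j : nat) (m : 'X_{1..2}) : bool :=
  ~~ (U_(0%R) *+ i <= m)%MM && ~~ (U_(1%R) *+ j <= m)%MM.

Definition divisibility_closed (M : {fset 'X_{1..2}}) : Prop :=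
  forall m m' : 'X_{1..2}, m \in M -> (m' <= m)%MM -> m' \in M.

Section Code.

(* F plays the role of the field with q ^ r elements. *)
Variables (F : finFieldType) (q r u : nat).

Definition Tr (y : F) : F := \sum_(i < r) y ^+ (q ^ i).

Definition curve : {set F * F} := [set P : F * F | P.1 ^+ u == Tr P.2].

Definition coords (P : F * F) : 'I_2 -> F := fun i => if i == 0 then P.1 else P.2.

(* The points P_1, ..., P_n are listed in the order of enum curve. *)
Definition ev (f : {mpoly F[2]}) : 'rV[F]_#|curve| :=
  \row_i f.@[coords (enum_val i)].

Definition lincomb (M : {fset 'X_{1..2}}) (a : {ffun M -> F^o}) : {mpoly F[2]} :=
  \sum_(m : M) a m *: 'X_[fsval m].

Definition ev_lincomb (M : {fset 'X_{1..2}}) (a : {ffun M -> F^o}) :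
  'rV[F]_#|curve| := ev (lincomb a).

Fact ev_lincomb_is_linear (M : {fset 'X_{1..2}}) : linear (@ev_lincomb M).
Proof.
move=> k a b; apply/rowP=> i; rewrite !mxE -mevalZ -mevalD; congr meval.
rewrite /lincomb scaler_sumr -big_split /=; apply: eq_bigr => m _.
by rewrite !ffunE scalerDl scalerA.
Qed.

HB.instance Definition _ (M : {fset 'X_{1..2}}) :=
  GRing.isLinear.Build F {ffun M -> F^o} 'rV[F]_#|curve| _ (@ev_lincomb M)
    (@ev_lincomb_is_linear M).

(* The image under ev of the F-span of M. *)
Definition norm_trace_code (M : {fset 'X_{1..2}}) : {vspace 'rV[F]_#|curve|} :=
  limg (linfun (@ev_lincomb M)).

Lemma mem_norm_trace_code (M : {fset 'X_{1..2}}) (c : 'rV[F]_#|curve|) :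
  c \in norm_trace_code M <-> exists a : {ffun M -> F^o}, c = ev (lincomb a).
Proof.
split=> [/memv_imgP[a _ ->]|[a ->]]; first by exists a; rewrite lfunE.
by apply/memv_imgP; exists a; rewrite ?memvf ?lfunE.
Qed.

End Code.

Definition hamming_weight (F : finFieldType) (n : nat) (c : 'rV[F]_n) : nat :=
  #|[set i : 'I_n | c 0 i != 0]|.

Definition is_min_distance (F : finFieldType) (n : nat)
    (C : {vspace 'rV[F]_n}) (d : nat) : Prop :=
  (exists c : 'rV[F]_n, [/\ c \in C, c != 0 & hamming_weight c = d]) /\
  (forall c : 'rV[F]_n, c \in C -> c != 0 -> (d <= hamming_weight c)%N).

(* Main.v *)
(* Put N = (q-1)u+1 and Q = q^(r-1), and give x^i y^j the weight iQ + ju. On the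
   curve y^Q equals x^u plus terms of lower weight, and x^N = x; hence every
   monomial reduces, without increasing the weight, to monomials x^i y^j with
   i < N and j < Q. These have distinct weights, and their evaluations are
   linearly independent, since N abscissae carry Q points each.
   Let f have leading monomial x^a y^b. The products of f with x^k y^l, for
   k < N-a and l < Q-b, or for k < N-a-u and Q-b <= l < Q, have distinct reduced
   leading monomials, so the evaluations of these x^k y^l are independent on the
   points where f does not vanish. The weight of ev(f) is thus at least
   (N-a)(Q-b) + max(N-a-u,0) b, which is NQ minus the minimum in the theorem.
   Equality is attained by a product of a factors x - alpha and b factors
   y - beta with Tr(beta) = 1, where the alpha avoid the u solutions of
   alpha^u = 1 for as long as possible. *)
Require Import Defs.
From mathcomp Require Import finfield zify.

Set Implicit Arguments.
Unset Strict Implicit.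
Unset Printing Implicit Defensive.

Import GRing.Theory.

(** * Counting in finite sets *)

(** At most [e] fibres with at most [k] points each can add up to [e * k] points only if both bounds
    are attained everywhere. This turns bounds on numbers of roots into exact counts. *)
Lemma card_fibre_tight (T T' : finType) (f : T -> T') (D : {set T})
    (E : {set T'}) (e k : nat) :
    {in D, forall x, f x \in E} -> #|E| <= e -> 0 < k -> #|D| = e * k ->
    {in E, forall y, #|[set x in D | f x == y]| <= k} ->
  #|E| = e /\ {in E, forall y, #|[set x in D | f x == y]| = k}.
Proof.
move=> fDE leE k_gt0 cardD lek.
have sumD : \sum_(y in E) #|[set x in D | f x == y]| = e * k.
  rewrite -cardD -sum1_card (partition_big f (mem E)) //=.
  apply: eq_bigr => y _; rewrite -sum1_card.
  by apply: eq_bigl => x; rewrite inE.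
have leif := leqif_sum (fun y (yE : y \in E) => leqif_eq (lek y yE)).
have cardE : #|E| = e.
  apply/eqP; rewrite eqn_leq leE -(leq_pmul2r k_gt0) -sumD -sum_nat_const.
  exact: (leif).
split=> // y yE; apply/eqP; move: (geq_leqif leif).
rewrite sumD sum_nat_const cardE leqnn => /esym/forallP/(_ y).
by rewrite yE.
Qed.

Lemma exists_subset_card (T : finType) (A : {set T}) (n : nat) :
  n <= #|A| -> exists2 B : {set T}, B \subset A & #|B| = n.
Proof.
move=> nA; exists [set x in take n (enum A)].
  by apply/subsetP => x; rewrite inE => /mem_take; rewrite mem_enum.
rewrite cardsE (card_uniqP _) ?take_uniq ?enum_uniq // size_takel //.
by rewrite -cardE.
Qed.

(* Among the [a]-subsets of [X], those that fill [X :\: C] first leave the most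
   of [C] uncovered. *)
Lemma exists_subset_card_setD (T : finType) (C X : {set T}) (a : nat) :
    C \subset X -> a <= #|X| ->
  exists2 A : {set T}, A \subset X
    & #|A| = a /\ #|C :\: A| = minn #|C| (#|X| - a).
Proof.
move=> CX aX.
have cardX : #|X :\: C| = #|X| - #|C| by rewrite cardsD (setIidPr CX).
have leC := subset_leq_card CX.
have [A1 A1s cardA1] := exists_subset_card (geq_minr a #|X :\: C|).
have [A2 A2s cardA2] := @exists_subset_card _ C (a - #|X :\: C|) ltac:(lia).
have A1C : [disjoint A1 & C].
  by apply: disjointWl A1s _; rewrite disjoints_subset subsetDr.
exists (A1 :|: A2); first by rewrite subUset (subset_trans A1s) ?subsetDl ?(subset_trans A2s).
split; first by rewrite cardsU disjoint_setI0 ?cards0 ?(disjointWr A2s) // cardA1 cardA2; lia.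
rewrite setDUr (setDidPl _) 1?disjoint_sym // (setIidPr (subsetDl _ _)).
by rewrite cardsD (setIidPr A2s) cardA2; lia.
Qed.

(** * Roots and power maps in a finite field *)

Section FieldCounts.

Local Open Scope ring_scope.

Variable F : finFieldType.

Lemma card_roots_le (p : {poly F}) (A : {set F}) (n : nat) :
  p != 0 -> (size p <= n.+1)%N -> {in A, forall x, root p x} -> (#|A| <= n)%N.
Proof.
move=> p0 sp rA; rewrite cardE -ltnS; apply: leq_trans sp.
apply: max_poly_roots => //; last exact: enum_uniq.
by apply/allP => x; rewrite mem_enum => /rA.
Qed.

Lemma card_expr_eq_le (d : nat) (c : F) :
  (0 < d)%N -> (#|[set x : F | x ^+ d == c]| <= d)%N.
Proof.
move=> d0; apply: (@card_roots_le ('X^d - c%:P)).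
- by rewrite -size_poly_eq0 size_XnsubC.
- by rewrite size_XnsubC.
by move=> x; rewrite inE => /eqP xd; rewrite rootE !hornerE xd subrr.
Qed.

(** The [d]-th power map sends the [d * m] nonzero elements to [m]-th roots of unity. There are at
    most [m] of these and each fibre has at most [d] elements, so [card_fibre_tight] applies. *)
Lemma card_expr_eq (d m : nat) (c : F) :
    (0 < d)%N -> (d * m)%N = #|F|.-1 -> c ^+ m = 1 ->
  #|[set x : F | x ^+ d == c]| = d.
Proof.
move=> d0 dm cm.
have F1 := finNzRing_gt1 F.
have m0 : (0 < m)%N.
  by rewrite lt0n; apply: contra_eq_neq dm => ->; rewrite muln0 ltn_eqF // -subn1 subn_gt0.
have c0 : c != 0.
  by apply: contra_eq_neq cm => ->; rewrite expr0n gtn_eqF // eq_sym oner_eq0.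
pose E : {set F} := [set y | y ^+ m == 1].
have [|||||_ fib] := @card_fibre_tight _ _ (fun x : F => x ^+ d) [set~ 0] E m d.
- move=> x; rewrite !inE => x0; rewrite -exprM dm.
  apply/eqP/(mulfI x0); rewrite -exprS prednK ?expf_card ?mulr1 //.
  exact: ltnW.
- exact: card_expr_eq_le.
- exact: d0.
- by rewrite cardsC1 -dm mulnC.
- move=> y _; apply: leq_trans (card_expr_eq_le y d0).
  by apply/subset_leq_card/subsetP => x; rewrite !inE => /andP[].
rewrite -[RHS](fib c) ?inE ?cm //; apply: eq_card => x; rewrite !inE.
have [->|_] /= := eqVneq x 0; last by [].
by rewrite expr0n gtn_eqF //= eq_sym (negPf c0).
Qed.

Lemma poly_eq0_roots (p : {poly F}) (A : {set F}) :
  (size p <= #|A|)%N -> {in A, forall x, root p x} -> p = 0.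
Proof.
move=> sp rA; apply/eqP; apply: contraTT sp => p0; rewrite -ltnNge.
have sp : size p = (size p).-1.+1 by rewrite prednK // size_poly_gt0.
by rewrite sp ltnS (card_roots_le p0) // -sp.
Qed.

End FieldCounts.

(** * The trace and the points of the curve *)

Section NormTraceCurve.

Local Open Scope ring_scope.

Variables (F : finFieldType) (p e q r u : nat).
Hypotheses (p_prime : prime p) (e_gt0 : (0 < e)%N) (q_def : q = (p ^ e)%N).
Hypotheses (r_ge2 : (2 <= r)%N) (card_F : #|F| = (q ^ r)%N).
Hypotheses (u_gt0 : (0 < u)%N) (u_dvd : (u %| (q ^ r - 1) %/ (q - 1))%N).

Local Notation N := ((q - 1) * u + 1)%N.
Local Notation Q := (q ^ (r - 1))%N.

Let q_gt1 : (1 < q)%N.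
Proof. by rewrite q_def -(exp1n e) ltn_exp2r // prime_gt1. Qed.

Let Q_gt0 : (0 < Q)%N.
Proof. by rewrite expn_gt0 (ltnW q_gt1). Qed.

Let cardFQ : #|F| = (q * Q)%N.
Proof. by rewrite card_F -expnS subn1 prednK // (ltnW r_ge2). Qed.

Lemma mul_u_pred_q : {m : nat | (u * (q - 1) * m)%N = #|F|.-1}.
Proof.
exists ((q ^ r - 1) %/ (q - 1) %/ u)%N.
rewrite mulnAC (mulnC u) divnK // divnK ?card_F ?subn1 //.
exact: dvdn_pred_predX.
Qed.

(** The consecutive integers |F| - 1 and |F| are multiples of [u] and of [q] respectively. *)
Lemma coprime_Q_u : coprime Q u.
Proof.
have [m um] := mul_u_pred_q.
apply: coprimeXl; apply: (@coprime_dvdr _ #|F|.-1); last first.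
  apply: (@coprime_dvdl _ #|F|); last by rewrite coprimenP // card_F expn_gt0 ltnW.
  by rewrite cardFQ dvdn_mulr.
by rewrite -um -mulnA dvdn_mulr.
Qed.

Let q_pchar : [pchar F].-nat q.
Proof.
have pF : p \in [pchar F].
  by apply: (@card_finPcharP _ p (e * r)) => //; rewrite card_F q_def expnM.
by rewrite q_def pnatX (eq_pnat _ (pcharf_eq pF)) pnat_id.
Qed.

(** The Frobenius map permutes the terms of the trace cyclically, because y^(q^r) = y. *)
Lemma Tr_frob (y : F) : Tr q r y ^+ q = Tr q r y.
Proof.
have sumX (I : Type) (s : seq I) (f : I -> F) :
    (\sum_(i <- s) f i) ^+ q = \sum_(i <- s) f i ^+ q.
  elim: s => [|i s IH]; first by rewrite !big_nil expr0n gtn_eqF // ltnW.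
  by rewrite !big_cons exprDn_pchar // IH.
rewrite /Tr sumX; case: r r_ge2 card_F => // k _ cF.
rewrite big_ord_recr [RHS]big_ord_recl /= -exprM -expnSr -cF expf_card addrC expn0.
rewrite expr1; congr (_ + _); apply: eq_bigr => i _.
by rewrite -exprM -expnSr.
Qed.

Lemma size_Tr_poly : size (\sum_(i < r) 'X^(q ^ i) : {poly F}) = Q.+1.
Proof.
case: r r_ge2 => // k _; rewrite subn1 /= big_ord_recr /=.
rewrite addrC size_polyDl size_polyXn // ltnS; apply: leq_trans (size_sum _ _ _) _.
by apply/bigmax_leqP => i _; rewrite size_polyXn ltn_exp2l.
Qed.

(** The trace polynomial has degree Q, and its values are among the at most [q] solutions of z^q =
    z. Since |F| = qQ, both bounds are tight. *)
Lemma card_Tr_fibre (c : F) : c ^+ q = c -> #|[set y : F | Tr q r y == c]| = Q.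
Proof.
have leQ (z : F) : (#|[set y : F | Tr q r y == z]| <= Q)%N.
  have sz : size (\sum_(i < r) 'X^(q ^ i) - z%:P) = Q.+1.
    by rewrite size_polyDl size_Tr_poly // size_polyN ltnS (leq_trans (size_polyC_leq1 _)).
  apply: (@card_roots_le _ (\sum_(i < r) 'X^(q ^ i) - z%:P)).
  - by rewrite -size_poly_eq0 sz.
  - by rewrite sz.
  move=> y; rewrite inE => /eqP <-.
  rewrite rootE !hornerE horner_sum subr_eq0; apply/eqP.
  by apply: eq_bigr => i _; rewrite !hornerE.
move=> cq; pose E : {set F} := [set z | z ^+ q == z].
have [|||||_ fib] := @card_fibre_tight _ _ (@Tr F q r) setT E q Q.
- by move=> y _; rewrite inE Tr_frob.
- apply: (@card_roots_le _ ('X^q - 'X)).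
  + by rewrite -size_poly_eq0 size_polyDl size_polyXn // size_polyN size_polyX.
  + by rewrite size_polyDl size_polyXn // size_polyN size_polyX.
  by move=> z; rewrite inE => /eqP zq; rewrite rootE !hornerE zq subrr.
- exact: Q_gt0.
- by rewrite cardsT cardFQ.
- by move=> z _; apply: leq_trans (leQ z); apply/subset_leq_card/subsetP => y; rewrite !inE.
by rewrite -[RHS](fib c) ?inE ?cq //; apply: eq_card => y; rewrite !inE.
Qed.

(** These are the x whose [u]-th power is a possible trace, hence the first coordinates of the
    points of the curve. *)
Definition abscissae : {set F} := [set x | (x ^+ u) ^+ q == x ^+ u].

(** Besides 0 these are the roots of unity of order dividing u(q-1), and u(q-1) divides |F| - 1. *)
Lemma card_abscissae : #|abscissae| = N.
Proof.
have [m um] := mul_u_pred_q.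
have uq0 : (0 < u * (q - 1))%N by rewrite muln_gt0 u_gt0 subn_gt0.
rewrite addn1 mulnC -(card_expr_eq uq0 um (expr1n _ _)).
rewrite (_ : abscissae = 0 |: [set x | x ^+ (u * (q - 1)) == 1]).
  by rewrite cardsU1 inE expr0n (gtn_eqF uq0) eq_sym oner_eq0.
apply/setP => x; rewrite !inE; have [->|x0] /= := eqVneq x 0.
  by rewrite !expr0n (gtn_eqF u_gt0) expr0n (gtn_eqF (ltnW q_gt1)) eqxx.
have xu0 : x ^+ u != 0 by rewrite expf_neq0.
by rewrite exprM -[RHS](inj_eq (mulIf xu0)) mul1r -exprSr subn1 prednK // ltnW.
Qed.

Lemma unit_class_sub : [set x : F | x ^+ u == 1] \subset abscissae.
Proof. by apply/subsetP => x; rewrite !inE => /eqP ->; rewrite expr1n. Qed.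

Lemma card_unit_class : #|[set x : F | x ^+ u == 1]| = u.
Proof.
have [m um] := mul_u_pred_q.
by apply: (@card_expr_eq _ u ((q - 1) * m)); rewrite ?mulnA ?expr1n.
Qed.

Lemma mem_curve (x y : F) :
  ((x, y) \in curve F q r u) = (x \in abscissae) && (Tr q r y == x ^+ u).
Proof.
rewrite !inE /= eq_sym; case: eqP => [<-|]; last by rewrite andbF.
by rewrite Tr_frob eqxx.
Qed.

Lemma card_curve_cond (P : pred (F * F)) :
  #|[set z in curve F q r u | P z]|
  = \sum_(x in abscissae) #|[set y | Tr q r y == x ^+ u & P (x, y)]|.
Proof.
rewrite -sum1_card.
under [RHS]eq_bigr do rewrite -sum1_card.
rewrite pair_big_dep /=; apply: eq_big => [[x y]|//].
by rewrite [LHS]in_set mem_curve -andbA; congr (_ && _); rewrite inE.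
Qed.

Lemma card_curve : #|curve F q r u| = (N * Q)%N.
Proof.
transitivity #|[set z in curve F q r u | predT z]|.
  by apply: eq_card => z; rewrite !inE andbT.
rewrite card_curve_cond -card_abscissae -sum_nat_const; apply: eq_bigr => x.
rewrite inE => /eqP xu; rewrite -(card_Tr_fibre xu).
by apply: eq_card => y; rewrite !inE andbT.
Qed.

Lemma expr_abscissa (x : F) : x \in abscissae -> x ^+ N = x.
Proof.
rewrite inE => /eqP xu; have [->|x0] := eqVneq x 0.
  by rewrite addn1 exprS mul0r.
(* After multiplication by x^u the exponents agree: u + N = uq + 1. *)
apply: (mulfI (expf_neq0 u x0)); rewrite -{2}xu -exprM -exprD -exprSr.
by congr (_ ^+ _); nia.
Qed.

(** * Weighted monomials and their independence on the curve *)

Definition mono (s : nat * nat) (P : F * F) : F := P.1 ^+ s.1 * P.2 ^+ s.2.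

(* The pole orders of x and y at infinity are Q and u: both sides of the
   equation of the curve have weight Q * u. *)
Definition wt (s : nat * nat) : nat := (s.1 * Q + s.2 * u)%N.

Lemma wtD (s t : nat * nat) : wt (s.1 + t.1, s.2 + t.2)%N = (wt s + wt t)%N.
Proof. by rewrite /wt !mulnDl addnACA. Qed.

Lemma monoD (s t : nat * nat) (P : F * F) : mono (s.1 + t.1, s.2 + t.2)%N P = mono s P * mono t P.
Proof. by rewrite /mono !exprD mulrACA. Qed.

(* Weights separate the monomials because Q is coprime to u. *)
Lemma wt_inj (s t : nat * nat) :
  (s.2 < Q)%N -> (t.2 < Q)%N -> wt s = wt t -> s = t.
Proof.
move=> sQ tQ st.
have mod_eq : s.2 = t.2.
  wlog le : s t sQ tQ st / (s.2 <= t.2)%N => [H|].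
    by case: (leqP s.2 t.2) => [|/ltnW] /H; [apply | move=> ->].
  have Qd : (Q %| t.2 - s.2)%N.
    rewrite -(Gauss_dvdl _ coprime_Q_u) mulnBl.
    have -> : (t.2 * u - s.2 * u = (s.1 - t.1) * Q)%N.
      by rewrite mulnBl -[LHS](subnDl (t.1 * Q)) -[(_ + t.2 * u)%N]st subnDr.
    exact: dvdn_mull.
  apply/eqP; rewrite eqn_leq le -subn_eq0.
  by case: posnP => // /dvdn_leq/(_ Qd); lia.
case: s t st mod_eq {sQ tQ} => [i j] [i' j'] /= + jj; rewrite jj /wt /= => /addIn/eqP.
by rewrite eqn_pmul2r // => /eqP ->.
Qed.

(** For a fixed abscissa x, a relation is a polynomial in y of degree below Q with Q roots, so all
    its coefficients vanish. Each coefficient is in turn a polynomial in x of degree below N that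
    vanishes at the N abscissae. *)
Lemma mono_free (I : finType) (t : I -> nat * nat) (a : I -> F) :
    injective t -> (forall k, (t k).1 < N /\ (t k).2 < Q)%N ->
    {in curve F q r u, forall P, \sum_k a k * mono (t k) P = 0} ->
  forall k, a k = 0.
Proof.
move=> t_inj t_box t0 k.
have px x : x \in abscissae -> \sum_k0 (a k0 * x ^+ (t k0).1) *: 'X^((t k0).2) = 0 :> {poly F}.
  move=> xA; have /card_Tr_fibre cardT : (x ^+ u) ^+ q = x ^+ u by move: xA; rewrite inE => /eqP.
  apply: (@poly_eq0_roots _ _ [set y | Tr q r y == x ^+ u]).
    rewrite cardT; apply: leq_trans (size_sum _ _ _) _; apply/bigmax_leqP => i _.
    by apply: leq_trans (size_scale_leq _ _) _; rewrite size_polyXn; case: (t_box i).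
  move=> y yT; have xyC : (x, y) \in curve F q r u by rewrite mem_curve xA; rewrite inE in yT.
  rewrite rootE horner_sum; apply/eqP; rewrite -[RHS](t0 _ xyC); apply: eq_bigr => i _.
  by rewrite hornerZ hornerXn /mono mulrA.
have qx : \sum_(k0 | (t k0).2 == (t k).2) a k0 *: 'X^((t k0).1) = 0 :> {poly F}.
  apply: (@poly_eq0_roots _ _ abscissae).
    rewrite card_abscissae; apply: leq_trans (size_sum _ _ _) _; apply/bigmax_leqP => i _.
    by apply: leq_trans (size_scale_leq _ _) _; rewrite size_polyXn; case: (t_box i).
  move=> x /px /(congr1 (fun p : {poly F} => p`_(t k).2)).
  rewrite coef_sum coef0 => x0; rewrite rootE horner_sum; apply/eqP.
  rewrite -[RHS]x0 big_mkcond; apply: eq_bigr => i _; rewrite coefZ coefXn eq_sym.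
  by case: eqP => _; rewrite !hornerE ?mulr1 ?mulr0.
move/(congr1 (fun p : {poly F} => p`_(t k).1)): qx.
rewrite coef_sum coef0 (bigD1 k) //= coefZ coefXn eqxx mulr1 big1 ?addr0 //.
move=> i /andP[/eqP i2 ik]; rewrite coefZ coefXn; case: eqP => [i1|]; rewrite ?mulr0 //.
by case/eqP: ik; apply: t_inj; rewrite [LHS]surjective_pairing -i1 i2 -surjective_pairing.
Qed.

(** * Reduction modulo the equation of the curve *)

(** This is the filtration by weight. It concerns functions rather than polynomials, so that
    monomials may be rewritten by any identity valid on the curve. *)
Definition below (W : nat) (h : F * F -> F) : Prop :=
  exists2 c : 'I_N * 'I_Q -> F,
    forall s : 'I_N * 'I_Q, (W <= wt (s.1 : nat, s.2 : nat))%N -> c s = 0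
  & {in curve F q r u, forall P, h P = \sum_s c s * mono (s.1 : nat, s.2 : nat) P}.

Lemma below_ext (W : nat) (h1 h2 : F * F -> F) :
  {in curve F q r u, h1 =1 h2} -> below W h1 -> below W h2.
Proof. by move=> h12 [c c0 hc]; exists c => // P PC; rewrite -h12 ?hc. Qed.

Lemma below_leq (W W' : nat) (h : F * F -> F) : (W <= W')%N -> below W h -> below W' h.
Proof. by move=> WW [c c0 hc]; exists c => // s /(leq_trans WW)/c0. Qed.

Lemma below_scaleD (W : nat) (k : F) (h1 h2 : F * F -> F) :
  below W h1 -> below W h2 -> below W (fun P => k * h1 P + h2 P).
Proof.
move=> [c c0 hc] [d d0 hd]; exists (fun s => k * c s + d s) => [s Ws|P PC].
  by rewrite c0 // d0 // mulr0 addr0.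
rewrite hc // hd // mulr_sumr -big_split; apply: eq_bigr => s _.
by rewrite /= mulrDl mulrA.
Qed.

Lemma below_sum (W : nat) (I : finType) (A : pred I) (a : I -> F) (h : I -> F * F -> F) :
  (forall i, A i -> below W (h i)) -> below W (fun P => \sum_(i | A i) a i * h i P).
Proof.
move=> hW; rewrite /index_enum; elim: (Finite.enum _) => [|i s IH].
  exists (fun _ => 0) => // P _; rewrite big_nil big1 // => s _; exact: mul0r.
have [Ai|nAi] := boolP (A i).
  apply: below_ext (below_scaleD (a i) (hW i Ai) IH) => P _; by rewrite big_cons Ai.
by apply: below_ext IH => P _; rewrite big_cons (negPf nAi).
Qed.

(** The equation of the curve is solved for y^Q, the top term of the trace. The factors [- 1] and
    [1] fit the shapes of [below_scaleD] and [below_sum]. *)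
Lemma mono_reduce_y (i j : nat) (P : F * F) : (Q <= j)%N -> P \in curve F q r u ->
  mono (i, j) P
  = - 1 * (\sum_(k < r.-1) 1 * mono (i, (j - Q + q ^ k)%N) P) + mono ((i + u)%N, (j - Q)%N) P.
Proof.
move=> Qj; rewrite inE => /eqP /= xu.
have yQ : P.2 ^+ Q = P.1 ^+ u - \sum_(k < r.-1) P.2 ^+ (q ^ k).
  by rewrite xu /Tr; case: r r_ge2 => // k _; rewrite big_ord_recr subn1 /= [RHS]addrC addKr.
rewrite /mono /= -{1}(subnK Qj) exprD yQ !mulrBr mulN1r [RHS]addrC.
congr (_ - _); first by rewrite exprD -mulrA [P.1 ^+ u * _]mulrC.
by rewrite !mulr_sumr; apply: eq_bigr => k _; rewrite mul1r exprD.
Qed.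

(** Induction on the weight plus the exponent of y. The second summand is needed since replacing y^Q
    by x^u keeps the weight and lowers only the exponent of y. *)
Lemma below_mono (s : nat * nat) : below (wt s).+1 (mono s).
Proof.
have [n] := ubnP (wt s + s.2); elim: n s => // n IH [i j]; rewrite ltnS /= => lt_n.
have lower t : (wt t + t.2 < wt (i, j) + j)%N -> (wt t <= wt (i, j))%N ->
    below (wt (i, j)).+1 (mono t).
  move=> lt le; apply: below_leq (IH t (leq_trans lt lt_n)); exact: le.
have [Qj|jQ] := leqP Q j.
  have C P PC := mono_reduce_y i Qj (P := P) PC.
  apply: (below_ext (fun P PC => esym (C P PC))).
  apply: below_scaleD; last first.
    by apply: lower; rewrite /wt /=; nia.
  apply: below_sum => k _.
  have kQ : (q ^ k < Q)%N by rewrite ltn_exp2l // subn1 ltn_ord.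
  by apply: lower; rewrite /wt /=; nia.
have [Ni|iN] := leqP N i.
  apply: (below_ext (h1 := mono (i - N + 1, j)%N)).
    move=> P; rewrite [P]surjective_pairing mem_curve => /andP[xA _].
    by rewrite /mono /= -{2}(subnK Ni) exprD expr1 [in RHS]exprD expr_abscissa.
  (* As N >= 2, replacing x^N by x strictly lowers the weight. *)
  apply: lower; rewrite /wt /=; nia.
exists (fun s => (s == (Ordinal iN, Ordinal jQ))%:R) => [s|P _].
  by case: eqP => // -> /=; rewrite ltnn.
rewrite (bigD1 (Ordinal iN, Ordinal jQ)) //= eqxx mul1r big1 ?addr0 // => s.
by move=> /negPf ->; rewrite mul0r.
Qed.

(** Otherwise moving the monomial to the other side gives a relation in the box whose coefficient at
    [s] is -1, against [mono_free]. *)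
Lemma box_not_below (s : nat * nat) :
  (s.1 < N)%N -> (s.2 < Q)%N -> ~ below (wt s) (mono s).
Proof.
case: s => i j /= iN jQ [c c0 hc]; pose s := (Ordinal iN, Ordinal jQ).
have := @mono_free _ (fun s : 'I_N * 'I_Q => (s.1 : nat, s.2 : nat))
  (fun t => c t - (t == s)%:R).
move=> /(_ _ _ _ s) free0; suff /eqP : c s - (s == s)%:R = 0.
  by rewrite eqxx c0 ?sub0r ?oppr_eq0 ?oner_eq0.
apply: free0; first by move=> [a b] [a' b'] [/val_inj-> /val_inj->].
- by move=> t; split; apply: ltn_ord.
- move=> P PC; under eq_bigr do rewrite mulrBl.
  rewrite sumrB -hc // (bigD1 s) //= eqxx mul1r big1 ?addr0 ?subrr // => t /negPf ->.
  exact: mul0r.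
Qed.

(** * Lower bound for the number of nonzeros *)

Lemma nonzero_left_kernel (m n : nat) (A : 'M[F]_(m, n)) :
  (n < m)%N -> exists2 v : 'rV_m, v != 0 & v *m A = 0.
Proof.
move=> nm; have /rowV0Pn[v /sub_kermxP vA v0] : kermx A != 0.
  by rewrite -mxrank_eq0 mxrank_ker subn_eq0 -ltnNge (leq_ltn_trans (rank_leq_col A)).
by exists v.
Qed.

(* The multiples [f * x^k * y^l], with [(k, l)] in [multiplier a b], have
   pairwise distinct leading basis monomials when [(a, b)] leads [f]. *)
Definition multiplier (a b : nat)
    (s : 'I_(N - a) * 'I_(Q - b) + 'I_(N - a - u) * 'I_b) : nat * nat :=
  match s with
  | inl k => (k.1 : nat, k.2 : nat)
  | inr k => (k.1 : nat, (Q - b + k.2)%N)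
  end.

Lemma multiplier_inj (a b : nat) : injective (@multiplier a b).
Proof.
move=> [[k l]|[k l]] [[k' l']|[k' l']] [] /=.
- by move=> /val_inj -> /val_inj ->.
- by have := ltn_ord l; lia.
- by have := ltn_ord l'; lia.
by move=> /val_inj -> /addnI/val_inj ->.
Qed.

(** With fewer nonzeros of f than multipliers, linear algebra gives a nontrivial combination g of
    multipliers that vanishes at all of these nonzeros. Then fg = 0 on the curve, which the leading
    term of fg contradicts. *)
Lemma weight_lower_bound (I : finType) (t : I -> nat * nat) (a : I -> F) :
    injective t -> (forall k, (t k).1 < N /\ (t k).2 < Q)%N ->
    (exists k, a k != 0) ->
  exists2 k, a k != 0 &
    ((N - (t k).1) * (Q - (t k).2) + (N - (t k).1 - u) * (t k).2
      <= #|[set P in curve F q r u | (\sum_k a k * mono (t k) P != 0)%R]|)%N.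
Proof.
move=> t_inj t_box [k1 k1P].
case: (arg_maxnP (P := fun k => a k != 0) (fun k => wt (t k)) k1P) => k0 k0P k0max.
exists k0 => //; rewrite leqNgt; apply/negP.
set Z := [set P in _ | _]; case tk0 : (t k0) => [i j] /=.
have [iN jQ] : (i < N /\ j < Q)%N by have := t_box k0; rewrite tk0.
set B := ('I_(N - i) * 'I_(Q - j) + 'I_(N - i - u) * 'I_j)%type.
have -> : ((N - i) * (Q - j) + (N - i - u) * j)%N = #|{: B}|.
  by rewrite card_sum !card_prod !card_ord.
pose s := @multiplier i j.
pose E : 'M_(#|{: B}|, #|Z|) := \matrix_(b, z) mono (s (enum_val b)) (enum_val z).
case/(nonzero_left_kernel E) => v /rV0Pn[b1 b1P] vE.
have fg P : P \in curve F q r u ->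
    (\sum_k a k * mono (t k) P) * (\sum_b v 0 b * mono (s (enum_val b)) P) = 0.
  move=> PC; have [->|fP] := eqVneq (\sum_k a k * mono (t k) P) 0; first exact: mul0r.
  have PZ : P \in Z by rewrite inE PC.
  move/rowP/(_ (enum_rank_in PZ P)): vE; rewrite !mxE => vE.
  apply/eqP; rewrite mulf_eq0 (negPf fP) /=; apply/eqP; rewrite -[RHS]vE.
  by apply: eq_bigr => b _; rewrite !mxE (enum_rankK_in PZ).
pose sb (b : 'I_#|{: B}|) := s (enum_val b).
have sb_inj : injective sb by move=> b b' /multiplier_inj/enum_val_inj.
have sb_Q b : ((sb b).2 < Q)%N.
  by rewrite /sb; case: (enum_val b) => [[k l]|[k l]] /=; have := ltn_ord l; lia.
(* The product of the leading monomial of f with a multiplier either lies in the box already or does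
   so after one replacement of y^Q by x^u. *)
have sb_N b : ((j + (sb b).2 < Q -> i + (sb b).1 < N)
    /\ (Q <= j + (sb b).2 -> i + (sb b).1 + u < N))%N.
  rewrite /sb; case: (enum_val b) => [[k l]|[k l]] /=.
    by have := ltn_ord k; have := ltn_ord l; lia.
  by have := ltn_ord k; have := ltn_ord l; lia.
case: (arg_maxnP (P := fun b => v 0 b != 0) (fun b => wt (sb b)) b1P) => b0 b0P b0max.
have c0 : a k0 * v 0 b0 != 0 by rewrite mulf_neq0.
pose st kb := ((t kb.1).1 + (sb kb.2).1, (t kb.1).2 + (sb kb.2).2)%N.
(* The relation fg = 0 is solved for the product of the two leading terms; every other term has
   strictly smaller weight. *)
have : below (wt (st (k0, b0))) (mono (st (k0, b0))).
  pose A kb := (kb != (k0, b0)) && (a kb.1 * v 0 kb.2 != 0).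
  pose d kb := - (a kb.1 * v 0 kb.2) / (a k0 * v 0 b0).
  have dP P : P \in curve F q r u ->
      \sum_(kb | A kb) d kb * mono (st kb) P = mono (st (k0, b0)) P.
    move=> PC; apply/(mulfI c0)/esym/eqP; rewrite -subr_eq0; apply/eqP.
    rewrite -[RHS](fg P PC).
    rewrite big_distrlr pair_bigA /= [RHS](bigD1 (k0, b0)) //=.
    rewrite monoD [X in _ = X + _]mulrACA; congr (_ + _).
    rewrite mulr_sumr -sumrN [LHS]big_mkcondr; apply: eq_bigr => kb _.
    case: ifPn => [_|/negPn/eqP z]; last by rewrite mulrACA z mul0r.
    by rewrite monoD /d [X in - X]mulrA [a k0 * _ * _]mulrC divfK // mulNr opprK mulrACA.
  apply: (below_ext dP).
  apply: below_sum => [[k b]] /andP[] /=.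
  rewrite mulf_eq0 negb_or => kb /andP[ak vb].
  apply: below_leq (below_mono _); rewrite !wtD /=.
  (* Equal total weights force equality in both factors, and then [wt_inj] gives the same pair of
     indices. *)
  have := leqif_add (leqif_eq (k0max k ak)) (leqif_eq (b0max b vb)).
  rewrite ltn_neqAle => -[-> ->]; rewrite andbT; apply: contraNN kb.
  case/andP => /eqP/wt_inj-/(_ (t_box _).2 (t_box _).2)/t_inj->.
  by move=> /eqP/wt_inj-/(_ (sb_Q _) (sb_Q _))/sb_inj->.
rewrite /st /= tk0 /=; have [N1 N2] := sb_N b0.
have [jsQ|Qjs] := ltnP (j + (sb b0).2) Q.
  by apply: box_not_below => //=; apply: N1.
(* The leading product leaves the box. Its replacement in the box has the same weight and differs
   from it only by terms of lower weight, so it would be [below] its own weight too. *)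
move=> bT; apply: (@box_not_below (i + (sb b0).1 + u, j + (sb b0).2 - Q)%N) => /=.
- exact: N2.
- by have := sb_Q b0; lia.
rewrite (_ : wt _ = wt (i + (sb b0).1, j + (sb b0).2)%N); last first.
  by rewrite /wt /= mulnDl mulnBl -addnA (mulnC u) subnKC // leq_mul2r Qjs orbT.
pose h (k : 'I_r.-1) := mono (i + (sb b0).1, j + (sb b0).2 - Q + q ^ k)%N.
apply: below_ext (below_scaleD 1 (below_sum (A := predT) (h := h) (fun=> 1) _) bT) => [P PC|k _].
  by rewrite /= (mono_reduce_y _ Qjs PC) mulN1r mul1r addrA subrr add0r.
have kQ : (q ^ k < Q)%N by rewrite ltn_exp2l // subn1 ltn_ord.
apply: below_leq (below_mono _).
rewrite /wt /= ltn_add2l ltn_pmul2r //; lia.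
Qed.

(** * Dimension of the code and weights of its words *)

Definition exps (m : 'X_{1..2}) : nat * nat := (m 0%R, m 1%R).

Lemma exps_inj : injective exps.
Proof.
move=> m m' [m0 m1]; apply/mnmP => i; have [->|->] : i = 0 \/ i = 1; [|by []..].
by case: i => [[|[|//]] lt_i]; [left | right]; apply: val_inj.
Qed.

Lemma evE (M : {fset 'X_{1..2}}) (a : {ffun M -> F^o}) :
  ev q r u (lincomb a)
  = \row_i \sum_(m : M) (a m : F) * mono (exps (fsval m)) (enum_val i).
Proof.
apply/rowP => i; rewrite !mxE /lincomb raddf_sum /=; apply: eq_bigr => m _.
rewrite mevalZ mevalX big_ord_recl big_ord1.
by rewrite (_ : fintype.lift _ _ = 1) //; apply: val_inj.
Qed.

Lemma row_mono_code (M : {fset 'X_{1..2}}) (m : 'X_{1..2}) : m \in M ->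
  \row_i mono (exps m) (enum_val i) \in norm_trace_code F q r u M.
Proof.
move=> mM; apply/mem_norm_trace_code.
exists [ffun k : M => (k == [` mM]%fset)%:R]; rewrite evE; apply/rowP => i.
rewrite !mxE (bigD1 [` mM]%fset) //= ffunE eqxx mul1r big1 ?addr0 // => k /negPf km.
by rewrite ffunE km mul0r.
Qed.

Lemma hamming_weight_row (h : F * F -> F) :
  hamming_weight (\row_(i < #|curve F q r u|) h (enum_val i))
  = #|[set P in curve F q r u | h P != 0]|.
Proof.
rewrite /hamming_weight -(card_imset _ enum_val_inj); apply: eq_card => P.
rewrite [in RHS]inE; apply/imsetP/andP => [[i + ->]|[PC hP]].
  by rewrite inE mxE enum_valP.
by exists (enum_rank_in PC P); rewrite ?inE ?mxE enum_rankK_in.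
Qed.

Section Code.

Variable M : {fset 'X_{1..2}}.
Hypothesis M_box : forall m : 'X_{1..2}, m \in M -> (m 0%R < N)%N /\ (m 1%R < Q)%N.

Lemma dim_norm_trace_code : \dim (norm_trace_code F q r u M) = #|` M|.
Proof.
rewrite /norm_trace_code limg_dim_eq.
  by rewrite dimvf cardfE -[RHS]muln1.
apply/eqP; rewrite capfv -subv0; apply/subvP => a; rewrite memv_ker lfunE /= memv0.
rewrite /ev_lincomb evE => /eqP a0; apply/eqP/ffunP => k; rewrite ffunE.
apply: (mono_free (t := exps \o val) (a := a)) => [|m|P PC].
- by move=> m m' /exps_inj/val_inj.
- exact/M_box/valP.
by move/rowP/(_ (enum_rank_in PC P)): a0; rewrite !mxE enum_rankK_in.
Qed.

Lemma hamming_weight_ge (c : 'rV[F]_#|curve F q r u|) :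
    c \in norm_trace_code F q r u M -> c != 0 ->
  exists2 m : 'X_{1..2}, m \in M
    & ((N - m 0%R) * (Q - m 1%R) + (N - m 0%R - u) * m 1%R <= hamming_weight c)%N.
Proof.
case/mem_norm_trace_code => a ->; rewrite evE => c0.
have [|||k _ kP] := @weight_lower_bound M (exps \o val) a.
- by move=> m m' /exps_inj/val_inj.
- by move=> m; apply/M_box/valP.
- apply/existsP; apply: contraNT c0; rewrite negb_exists => /forallP a0.
  apply/eqP/rowP => i; rewrite !mxE big1 // => m _.
  by move/negPn/eqP: (a0 m) => ->; rewrite mul0r.
exists (val k); first exact: valP.
by rewrite (hamming_weight_row (fun P => \sum_k a k * mono (exps (val k)) P)).
Qed.

Lemma hamming_weight_attained (m : 'X_{1..2}) :
    divisibility_closed M -> m \in M ->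
  exists2 c, c \in norm_trace_code F q r u M
    & hamming_weight c = ((N - m 0%R) * Q - minn u (N - m 0%R) * m 1%R)%N.
Proof.
move=> M_closed mM; have [m0N m1Q] := M_box mM.
have [|A AX [cardA cardCA]] :=
  @exists_subset_card_setD F [set x | x ^+ u == 1] abscissae (m 0%R) unit_class_sub.
  by rewrite card_abscissae ltnW.
rewrite card_unit_class card_abscissae in cardCA.
have [S ST cardS] : exists2 S : {set F}, S \subset [set y | Tr q r y == 1] & #|S| = m 1%R.
  by apply: exists_subset_card; rewrite card_Tr_fibre ?expr1n // ltnW.
pose f := \prod_(x <- enum A) ('X - x%:P) : {poly F}.
pose g := \prod_(y <- enum S) ('X - y%:P) : {poly F}.
have sf : size f = (m 0%R).+1 by rewrite size_prod_XsubC -cardE cardA.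
have sg : size g = (m 1%R).+1 by rewrite size_prod_XsubC -cardE cardS.
exists (\row_i (f.[(enum_val i).1] * g.[(enum_val i).2])).
  (* The product f(x)g(y) expands into monomials that divide [m], all in [M] by closure. *)
  rewrite (_ : \row_i _ = \sum_(k < (m 0%R).+1) \sum_(l < (m 1%R).+1)
    (f`_k * g`_l) *: \row_i mono (k : nat, l : nat) (enum_val i)); last first.
    apply/rowP => i; rewrite mxE summxE -sf -sg !horner_coef big_distrlr.
    apply: eq_bigr => k _; rewrite summxE; apply: eq_bigr => l _.
    by rewrite !mxE /mono /= mulrACA.
  apply: memv_suml => k _; apply: memv_suml => l _; apply: memvZ.
  pose m' := [multinom if i == 0%R then k : nat else l | i < 2] : 'X_{1..2}.
  have <- : exps m' = (k : nat, l : nat) by rewrite /exps !mnmE.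
  apply/row_mono_code/(M_closed m) => //; apply/mnm_lepP => i; rewrite mnmE.
  case: i => [[|[|//]] lt_i] /=.
    by rewrite (_ : Ordinal lt_i = 0) //; [rewrite -ltnS | apply: val_inj].
  by rewrite (_ : Ordinal lt_i = 1) //; [rewrite -ltnS | apply: val_inj].
rewrite (@hamming_weight_row (fun P => f.[P.1] * g.[P.2])) card_curve_cond.
(* The points removed by g are added back, which avoids truncated subtraction. *)
apply/eqP; rewrite -(eqn_add2r (minn u (N - m 0%R) * m 1%R)) subnK; last first.
  by rewrite leq_mul ?geq_minr // ltnW.
have CX : [set x : F | x ^+ u == 1] :\: A \subset abscissae.
  exact: subset_trans (subsetDl _ _) unit_class_sub.
rewrite -cardCA.
have <- : #|abscissae :\: A| = (N - m 0%R)%N.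
  by rewrite cardsD (setIidPr AX) card_abscissae cardA.
have fA x : (f.[x] == 0) = (x \in A) by rewrite -rootE root_prod_XsubC mem_enum.
have gS y : (g.[y] == 0) = (y \in S) by rewrite -rootE root_prod_XsubC mem_enum.
rewrite (big_setID A) /= (setIidPr AX) big1 ?add0n => [|x xA]; last first.
  apply/eqP; rewrite cards_eq0; apply/eqP/setP => y.
  by rewrite !inE -fA in xA *; rewrite (eqP xA) mul0r eqxx andbF.
rewrite -!sum_nat_const.
(* The removed points are charged to the abscissae with x^u = 1: [S] lies in the fibre over each of
   these and misses all other fibres. *)
rewrite (_ : \sum_(x in _ :\: A) m 1%R
  = \sum_(x in abscissae :\: A) (x ^+ u == 1%R) * m 1%R)%N; last first.
  rewrite [LHS]big_mkcond [RHS]big_mkcond; apply: eq_bigr => x _.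
  rewrite !inE; case: eqP => [->|_]; last by rewrite andbF mul0n if_same.
  by rewrite expr1n eqxx mul1n.
rewrite -big_split; apply/eqP; apply: eq_bigr => x; rewrite inE => /andP[xA xX].
rewrite /= -(@card_Tr_fibre (x ^+ u)); last by move: xX; rewrite inE => /eqP.
case: eqP => [xu1|xu].
  rewrite mul1n -cardS -(cardsID S [set y | Tr q r y == x ^+ u]) (setIidPr _) ?xu1 //.
  rewrite addnC; congr (_ + _)%N; apply: eq_card => y.
  by rewrite !inE mulf_eq0 negb_or fA gS xA andbC.
rewrite addn0; apply: eq_card => y; rewrite !inE mulf_eq0 negb_or fA gS xA /=.
case: eqP => //= yx; apply/negP => yS; case: xu; rewrite -yx; apply/eqP.
by have := subsetP ST y yS; rewrite inE.
Qed.

End Code.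

End NormTraceCurve.

(** * The three parameters of the code *)

Theorem theorem4p3 (F : finFieldType) (p e q r u : nat) (M : {fset 'X_{1..2}})
    (p_prime : prime p) (e_gt0 : 0 < e) (q_def : q = p ^ e)
    (r_ge2 : 2 <= r) (card_F : #|F| = q ^ r)
    (u_gt0 : 0 < u) (u_dvd : u %| (q ^ r - 1) %/ (q - 1))
    (M_neq0 : M != fset0)
    (M_Delta : forall m : 'X_{1..2}, m \in M ->
       in_Delta ((q - 1) * u + 1) (q ^ (r - 1)) m)
    (M_closed : divisibility_closed M) :
  [/\ #|curve F q r u| = ((q - 1) * u + 1) * q ^ (r - 1),
      \dim (norm_trace_code F q r u M) = #|` M|
    & is_min_distance (norm_trace_code F q r u M)
        (((q - 1) * u + 1) * q ^ (r - 1)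
         - \max_(m <- enum_fset M)
             minn (m 0%R * q ^ (r - 1) + (u * (q - 1) + 1 - m 0%R) * m 1%R)
                  (m 0%R * q ^ (r - 1) + m 1%R * u))].

Proof.
have M_box (m : 'X_{1..2}) : m \in M ->
    m 0%R < (q - 1) * u + 1 /\ m 1%R < q ^ (r - 1).
  move=> /M_Delta /andP[m0 m1]; rewrite !ltnNge; split.
    apply: contraNN m0 => m0; apply/mnm_lepP => i; rewrite mulmnE mnm1E.
    by case: eqP => [<-|_]; rewrite ?mul1n ?mul0n.
  apply: contraNN m1 => m1; apply/mnm_lepP => i; rewrite mulmnE mnm1E.
  by case: eqP => [<-|_]; rewrite ?mul1n ?mul0n.
split.
- exact: (card_curve p_prime e_gt0 q_def r_ge2 card_F u_gt0 u_dvd).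
- exact: (dim_norm_trace_code p_prime e_gt0 q_def r_ge2 card_F u_gt0 u_dvd M_box).
set N := (q - 1) * u + 1 in M_box *; set Q := q ^ (r - 1) in M_box *.
pose w (m : 'X_{1..2}) :=
  minn (m 0%R * Q + (u * (q - 1) + 1 - m 0%R) * m 1%R) (m 0%R * Q + m 1%R * u).
have wE m : w m = m 0%R * Q + minn u (N - m 0%R) * m 1%R.
  by rewrite /w -addn_minr (mulnC u) [m 1%R * u]mulnC -minnMl minnC.
(* This identifies the lower bound for the weight with the formula of the theorem. The truncated
   [N - m 0%R - u] covers both cases of the minimum. *)
have NQ_sub (m : 'X_{1..2}) : m \in M ->
    N * Q - w m = (N - m 0%R) * (Q - m 1%R) + (N - m 0%R - u) * m 1%R.
  case/M_box => aN bQ; rewrite wE subnDA -mulnBl.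
  have := subnK (ltnW bQ); set k := Q - _ => <-; set n := N - m 0%R.
  rewrite mulnDr; case: (leqP u n) => un.
    by rewrite -addnBA ?leq_mul2r ?un ?orbT // mulnBl.
  by rewrite addnK (eqP (ltnW un : n - u == 0)) addn0.
split.
  have [m mM ->] : exists2 m : 'X_{1..2}, m \in M & \max_(m <- enum_fset M) w m = w m.
    have [m0 m0M] := fset0Pn _ M_neq0.
    rewrite big_seq_fsetE /=.
    have [|m ->] := @eq_bigmax M (fun m => w (val m)).
      by apply/card_gt0P; exists [` m0M]%fset.
    by exists (val m); first exact: valP.
  have [c cM cw] :=
    hamming_weight_attained p_prime e_gt0 q_def r_ge2 card_F u_gt0 u_dvd M_box M_closed mM.
  rewrite -/N -/Q in cw.
  have cE : hamming_weight c = N * Q - w m by rewrite cw wE subnDA -mulnBl.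
  exists c; split=> //; have [aN bQ] := M_box m mM.
  (* The word is nonzero because its weight is at least (N-a)(Q-b), which is positive in the box. *)
  apply: contraTneq (_ : 0 < hamming_weight c) => [->|].
    rewrite -leqNgt leqn0 cards_eq0; apply/eqP/setP => i.
    by rewrite !inE mxE eqxx.
  by rewrite cE NQ_sub // addn_gt0 muln_gt0 !subn_gt0 aN bQ.
move=> c cM c0.
have [m mM] :=
  hamming_weight_ge p_prime e_gt0 q_def r_ge2 card_F u_gt0 u_dvd M_box cM c0.
rewrite -/N -/Q -NQ_sub //; apply: leq_trans; apply: leq_sub2l.
exact: (@leq_bigmax_seq _ _ predT w m mM).
Qed.
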